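(* Let $G$ be a finite simple graph with stability number $\alpha(G)=2$. Then $K[\mathcal{Q}_G]\simeq K[\mathcal{P}_{\overline{G}^\star}]$. Moreover, if $\overline{G}$ is bipartite, then there exists a bipartite graph $H$ such that $K[\mathcal{Q}_G]\simeq K[\mathcal{P}_H]$.
   Context: $G$ is a graph on $[n]=\{1,\dots,n\}$; $\overline{G}$ is its complement with edge set $E(\overline{G})$. A subset $W\subset[n]$ is stable if no two distinct elements of $W$ form an edge of $G$ (the empty set and singletons are stable); $\alpha(G)$ is the largest cardinality of a stable set. With $\rho(W)=\sum_{j\in W}\mathbf{e}_j$, the stable set polytope $\mathcal{Q}_G\subset\mathbb{R}^n$ is the convex hull of the $\rho(W)$ for $W$ stable in $G$. The edge polytope $\mathcal{P}_H$ of a graph $H$ (loops allowed, no multiple edges) is the convex hull of the vectors $\mathbf{e}_i+\mathbf{e}_j$ for edges $\{i,j\}$ of $H$ and $2\mathbf{e}_i$ for loops at $i$ in $H$. $\overline{G}^\star$ is the nonsimple graph on $[n+1]$ whose set of edges and loops is $E(\overline{G})\cup\{\{i,n+1\}: i\in[n+1]\}$ (so there is exactly one loop, at $n+1$). Let $K$ be a field. For an integral convex polytope $\mathcal{P}\subset\mathbb{R}^d$ with $\mathcal{P}\cap\mathbb{Z}^d=\{\mathbf{a}_1,\dots,\mathbf{a}_m\}$, the toric ring $K[\mathcal{P}]$ is the $K$-subalgebra of $K[x_1^{\pm1},\dots,x_d^{\pm1},t]$ generated by $X^{\mathbf{a}_1}t,\dots,X^{\mathbf{a}_m}t$ (where $X^{\mathbf{a}}=x_1^{a_1}\cdots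 x_d^{a_d}$), regarded as a homogeneous algebra with each $\deg X^{\mathbf{a}_i}t=1$. The symbol $\simeq$ denotes isomorphism of $K$-algebras. *)

(* Defs.v *)
From HB Require Import structures.
From mathcomp Require Import all_boot all_order all_algebra.
From mathcomp Require Import finmap monalg.
From mathcomp Require Import boolp classical_sets reals.

Set Implicit Arguments.
Unset Strict Implicit.
Unset Printing Implicit Defensive.

Import Order.TTheory GRing.Theory Num.Theory.

Local Open Scope classical_set_scope.
Local Open Scope ring_scope.

(* Graphs on [n], with loops allowed and no multiple edges; the vertex k of   *)
(* [n] = {1, ..., n} is the ordinal k - 1 of 'I_n.                            *)
Record graph (n : nat) : Type := Graph {
  adj :> rel 'I_n;
  adj_sym : symmetric adj
}.

Section Graphs.
Context {n : nat} (G : graph n).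
Implicit Types W A : {set 'I_n}.

Definition simple_graph : bool := [forall i, ~~ G i i].

Definition stable W : bool :=
  [forall i in W, forall j in W, (i != j) ==> ~~ G i j].

Definition stability_number : nat := \max_(W : {set 'I_n} | stable W) #|W|.

Definition bipartite : Prop :=
  exists A, forall i j, G i j -> (i \in A) != (j \in A).

Definition compl_adj : rel 'I_n := fun i j => (i != j) && ~~ G i j.

Fact compl_adj_sym : symmetric compl_adj.
Proof. by move=> i j; rewrite /compl_adj eq_sym adj_sym. Qed.

Definition graph_compl : graph n := Graph compl_adj_sym.

(* The new vertex is ord_max; unlift ord_max i = Some a iff i is the old      *)
(* vertex a.  The pair (ord_max, ord_max) is adjacent: this is the loop.      *)
Definition star_adj : rel 'I_n.+1 := fun i j =>
  match unlift ord_max i, unlift ord_max j with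
  | Some a, Some b => G a b
  | _, _ => true
  end.

Fact star_adj_sym : symmetric star_adj.
Proof.
move=> i j; rewrite /star_adj.
by case: (unlift _ i) (unlift _ j) => [a|] [b|] //; rewrite adj_sym.
Qed.

Definition graph_star : graph n.+1 := Graph star_adj_sym.

End Graphs.

Section Polytopes.
Context (R : realType).

Definition conv_hull (d : nat) (S : set 'rV[R]_d) : set 'rV[R]_d :=
  [set x | exists m (p : 'I_m -> 'rV[R]_d) (c : 'I_m -> R),
    [/\ forall i, S (p i), forall i, 0 <= c i, \sum_i c i = 1 &
        x = \sum_i c i *: p i]].

Definition unit_vec (d : nat) (i : 'I_d) : 'rV[R]_d := delta_mx 0 i.

Definition char_vec (d : nat) (W : {set 'I_d}) : 'rV[R]_d :=
  \sum_(j in W) unit_vec j.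

Definition stable_set_polytope (n : nat) (G : graph n) : set 'rV[R]_n :=
  conv_hull [set x | exists2 W : {set 'I_n}, stable G W & x = char_vec W].

(* A loop at i contributes the point 2 e_i (case i = j).                      *)
Definition edge_polytope (n : nat) (H : graph n) : set 'rV[R]_n :=
  conv_hull [set x | exists i j, H i j /\ x = unit_vec i + unit_vec j].

Definition lattice_points (d : nat) (P : set 'rV[R]_d) : set 'rV[int]_d :=
  [set a | P (map_mx intr a)].

End Polytopes.

Arguments stable_set_polytope R {n} G.
Arguments edge_polytope R {n} H.

(* The monoid algebra K[M] of an additive commutative monoid M: finitely      *)
(* supported functions M -> K with the convolution product.  The ring         *)
(* structure of {malg K[M]} in monalg is restricted to monoids without        *)
(* nontrivial units, which excludes Laurent exponents, hence this copy.       *)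
Definition monoid_algebra (K : fieldType) (M : nmodType) : Type := {malg K[M]}.

Section MonoidAlgebra.
Context (K : fieldType) (M : nmodType).
Local Notation A := (monoid_algebra K M).

HB.instance Definition _ := GRing.Lmodule.copy A {malg K[M]}.

Implicit Types g : A.

Definition monom (k : M) : A := << 1 *g k >>.

Definition ma_mul (g1 g2 : A) : A :=
  \sum_(k1 <- msupp g1) \sum_(k2 <- msupp g2)
     (<< g1@_k1 * g2@_k2 *g k1 + k2 >> : A).

Fact ma_mulw (d1 d2 : {fset M}) g1 g2 :
  (msupp g1 `<=` d1)%fset -> (msupp g2 `<=` d2)%fset ->
  ma_mul g1 g2 = \sum_(k1 <- d1) \sum_(k2 <- d2)
     (<< g1@_k1 * g2@_k2 *g k1 + k2 >> : A).
Proof.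
move=> le_d1 le_d2; rewrite /ma_mul (big_fset_incl _ le_d1) /=.
  apply/eq_bigr=> k1 _; apply/big_fset_incl => // k _ /mcoeff_outdom ->.
  by rewrite mulr0 monalgU0.
move=> k _ /mcoeff_outdom g1k.
by rewrite big1 => // k' _; rewrite g1k mul0r monalgU0.
Qed.

Fact ma_mulC : commutative ma_mul.
Proof.
move=> g1 g2; rewrite /ma_mul exchange_big /=.
by apply: eq_bigr => i _; apply: eq_bigr => j _; rewrite mulrC addrC.
Qed.

Fact ma_mulDl : left_distributive ma_mul +%R.
Proof.
move=> g1 g2 g.
rewrite (ma_mulw (msuppD_le g1 g2) (fsubset_refl (msupp g))).
rewrite (ma_mulw (fsubsetUl _ (msupp g2)) (fsubset_refl (msupp g))).
rewrite (ma_mulw (fsubsetUr (msupp g1) _) (fsubset_refl (msupp g))).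
rewrite -big_split /=; apply/eq_bigr=> k1 _.
rewrite -big_split /=; apply/eq_bigr=> k2 _.
by rewrite mcoeffD mulrDl monalgUD.
Qed.

Fact ma_mulUU (c1 c2 : K) (k1 k2 : M) :
  ma_mul << c1 *g k1 >> << c2 *g k2 >> = << c1 * c2 *g k1 + k2 >>.
Proof.
by rewrite (ma_mulw msuppU_le msuppU_le) !big_seq_fset1 !mcoeffUU.
Qed.

Fact ma_mul0 g : ma_mul 0 g = 0.
Proof. by rewrite /ma_mul msupp0 big_seq_fset0. Qed.

Fact ma_mul_suml (I : Type) (r : seq I) (F : I -> A) g :
  ma_mul (\sum_(i <- r) F i) g = \sum_(i <- r) ma_mul (F i) g.
Proof.
exact: (big_morph (ma_mul^~ g) (fun _ _ => ma_mulDl _ _ _) (ma_mul0 g)).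
Qed.

Fact ma_mul_sumr (I : Type) (r : seq I) (F : I -> A) g :
  ma_mul g (\sum_(i <- r) F i) = \sum_(i <- r) ma_mul g (F i).
Proof.
by rewrite ma_mulC ma_mul_suml; apply: eq_bigr => i _; rewrite ma_mulC.
Qed.

Fact ma_sumE g : g = \sum_(k <- msupp g) (<< g@_k *g k >> : A).
Proof. exact: monalgE. Qed.

Fact ma_mulA : associative ma_mul.
Proof.
move=> g1 g2 g3; rewrite (ma_sumE g1) (ma_sumE g2) (ma_sumE g3).
rewrite !ma_mul_suml; apply: eq_bigr => i _.
rewrite ma_mul_sumr [X in _ = ma_mul X _]ma_mul_sumr ma_mul_suml.
apply: eq_bigr => j _; rewrite !ma_mul_sumr.
by apply: eq_bigr => k _; rewrite !ma_mulUU mulrA addrA.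
Qed.

Fact ma_mul1 : left_id (monom 0) ma_mul.
Proof.
move=> g; rewrite [in LHS](ma_sumE g) ma_mul_sumr [RHS]ma_sumE.
by apply: eq_bigr => k _; rewrite ma_mulUU mul1r add0r.
Qed.

Fact ma_one_neq0 : monom 0 != 0.
Proof. by rewrite monalgU_eq0 oner_eq0. Qed.

HB.instance Definition _ := GRing.Zmodule_isComNzRing.Build A
  ma_mulA ma_mulC ma_mul1 ma_mulDl ma_one_neq0.

Fact ma_scaleU (c x : K) (k : M) :
  c *: (<< x *g k >> : A) = << c * x *g k >>.
Proof. by apply/malgP=> l; rewrite mcoeffZ !mcoeffU mulrnAr. Qed.

Fact ma_scaleE (c : K) g : c *: g = (<< c *g 0 >> : A) * g.
Proof.
rewrite [X in c *: X]ma_sumE [X in _ * X]ma_sumE.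
rewrite scaler_sumr [RHS]ma_mul_sumr; apply: eq_bigr => k _.
by rewrite ma_scaleU ma_mulUU add0r.
Qed.

Fact ma_scaleAl (c : K) g1 g2 : c *: (g1 * g2) = (c *: g1) * g2.
Proof. by rewrite !ma_scaleE mulrA. Qed.

HB.instance Definition _ := GRing.Lmodule_isLalgebra.Build K A ma_scaleAl.
HB.instance Definition _ := GRing.Lalgebra_isComAlgebra.Build K A.

End MonoidAlgebra.

(* K[x_1^{+-1}, ..., x_d^{+-1}, t]; the exponent (a, r) stands for X^a t^r.   *)
Definition laurent (K : fieldType) (d : nat) : comAlgType K :=
  monoid_algebra K ('rV[int]_d * nat)%type.

Section GeneratedSubalgebra.
Context (K : fieldType) (A : comAlgType K) (S : set A).

Definition gen_subalg : set A := smallest (fun B => subalg_closed [in B]) S.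

Definition in_gen_subalg : {pred A} := [in gen_subalg].

Fact gen_subalg_closed : subalg_closed in_gen_subalg.
Proof.
split.
- by rewrite inE => B [[B1 _ _] _]; have := B1; rewrite inE.
- move=> a u v; rewrite !inE => gu gv B [cB sB]; have [_ Blin _] := cB.
  apply: set_mem; apply: Blin; apply: mem_set; [exact: gu | exact: gv].
- move=> u v; rewrite !inE => gu gv B [cB sB]; have [_ _ Bmul] := cB.
  apply: set_mem; apply: Bmul; apply: mem_set; [exact: gu | exact: gv].
Qed.

HB.instance Definition _ := GRing.isSubalgClosed.Build K A in_gen_subalg
  (GRing.subalg_closed_semi gen_subalg_closed).

Record subalgebra : Type := Subalgebra {
  subalgebra_val :> A;
  subalgebra_valP : subalgebra_val \in in_gen_subalg
}.

HB.instance Definition _ := [isSub for subalgebra_val].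
HB.instance Definition _ := [Choice of subalgebra by <:].
HB.instance Definition _ := [SubChoice_isSubAlgebra of subalgebra by <:].
HB.instance Definition _ := [SubNzRing_isSubComNzRing of subalgebra by <:].

End GeneratedSubalgebra.

Definition toric_ring (K : fieldType) (R : realType) (d : nat)
    (P : set 'rV[R]_d) : algType K :=
  subalgebra
    [set f : laurent K d |
       exists2 a : 'rV[int]_d, lattice_points P a & f = monom K (a, 1%N)].

Definition alg_isomorphic (K : fieldType) (A B : algType K) : Prop :=
  exists f : {lrmorphism A -> B}, bijective f.

(* Main.v *)
Require Import Defs.
From HB Require Import structures.
From mathcomp Require Import all_boot all_order all_algebra.
From mathcomp Require Import finmap monalg.
From mathcomp Require Import boolp classical_sets functions reals.

(** If [alpha(G) = 2], the stable sets of [G] are the empty set, the singletons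
    and the edges of the complement.  Fixing two extra vertices [p], [q] (equal
    for the first claim) and sending each [e_i] to [e_i - e_(k i)] with
    [k i] in [{p, q}] and the origin to [e_p + e_q], one obtains an affine map
    with an integral affine retraction, which carries the vertices of the stable
    set polytope to the vertices of the edge polytope; for the second claim,
    [k i] is [p] or [q] according to the side of [i] in the bipartition.  Such a
    map identifies the lattice points of the two polytopes and induces an
    injective map of Laurent polynomial rings matching the generators of the two
    toric rings. *)

Set Implicit Arguments.
Unset Strict Implicit.
Unset Printing Implicit Defensive.

Import GRing.Theory.

Local Open Scope classical_set_scope.
Local Open Scope ring_scope.

(** * Functoriality of monoid algebras *)

Section MonoidAlgebraMap.
Context (K : fieldType) (M M' : nmodType).
Local Notation A := (monoid_algebra K M).
Local Notation A' := (monoid_algebra K M').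

Definition ma_map (h : M -> M') (g : A) : A' :=
  \sum_(k <- msupp g) (<< g@_k *g h k >> : A').

Lemma ma_mapw (h : M -> M') (d : {fset M}) (g : A) :
  (msupp g `<=` d)%fset -> ma_map h g = \sum_(k <- d) (<< g@_k *g h k >> : A').
Proof.
move=> le_d; rewrite /ma_map (big_fset_incl _ le_d) //= => k _ /mcoeff_outdom ->.
by rewrite monalgU0.
Qed.

Fact ma_map_linear (h : M -> M') : linear (ma_map h).
Proof.
move=> c g1 g2.
have le_d : (msupp (c *: g1 + g2) `<=` msupp g1 `|` msupp g2)%fset.
  apply: fsubset_trans (msuppD_le _ _) _; apply: fsetSU; exact: msuppZ_le.
rewrite (ma_mapw h le_d) (ma_mapw h (fsubsetUl _ (msupp g2))).
rewrite (ma_mapw h (fsubsetUr (msupp g1) _)) scaler_sumr -big_split /=.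
by apply: eq_bigr => k _; rewrite ma_scaleU mcoeffD mcoeffZ monalgUD.
Qed.

HB.instance Definition _ (h : M -> M') :=
  GRing.isLinear.Build K A A' *:%R (ma_map h) (ma_map_linear h).

Lemma ma_mapU (h : M -> M') (c : K) (k : M) :
  ma_map h << c *g k >> = << c *g h k >>.
Proof. by rewrite (ma_mapw h msuppU_le) big_seq_fset1 mcoeffUU. Qed.

Fact ma_map_monoid_morphism (h : {additive M -> M'}) :
  monoid_morphism (ma_map h).
Proof.
split=> [|g1 g2]; first by rewrite [LHS]ma_mapU raddf0.
rewrite [X in ma_map h (X * _)]ma_sumE [X in ma_map h (_ * X)]ma_sumE.
rewrite [X in ma_map h X]ma_mul_suml raddf_sum [RHS]ma_mul_suml.
apply: eq_bigr => k1 _ /=; rewrite [X in ma_map h X = _]ma_mul_sumr raddf_sum.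
rewrite [RHS]ma_mul_sumr; apply: eq_bigr => k2 _.
by rewrite !ma_mulUU /= ma_mapU raddfD.
Qed.

HB.instance Definition _ (h : {additive M -> M'}) :=
  GRing.isMonoidMorphism.Build A A' (ma_map h) (ma_map_monoid_morphism h).

(** An injective [h] merges no two exponents, so the coefficient of the image at [h k] is the
    original one at [k]. *)
Lemma ma_map_inj (h : M -> M') : injective h -> injective (ma_map h).
Proof.
move=> h_inj; suff mapE (g : A) k : (ma_map h g)@_(h k) = g@_k.
  by move=> g1 g2 eq_g; apply/malgP => k; rewrite -!mapE eq_g.
rewrite /ma_map [X in X@_k]ma_sumE !raddf_sum; apply: eq_bigr => l _.
by rewrite /= !mcoeffU (inj_eq h_inj).
Qed.

End MonoidAlgebraMap.

(** * Generated subalgebras under algebra morphisms *)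

Section GeneratedSubalgebraImage.
Context (K : fieldType) (A B : comAlgType K) (F : {lrmorphism A -> B}).
Context (S : set A).

(** Both inclusions come from minimality: images and preimages of subalgebras under [F] are
    subalgebras. *)
Lemma gen_subalg_image : gen_subalg (F @` S) = F @` gen_subalg S.
Proof.
apply/seteqP; split=> [y|_ [x Sx <-]].
  apply; split; last first.
    by move=> _ [x Sx <-]; exists x => // C [_]; apply.
  have [gen1 genL genM] := gen_subalg_closed S.
  split=> [|a _ _ /set_mem[u gu <-] /set_mem[v gv <-]
           |_ _ /set_mem[u gu <-] /set_mem[v gv <-]]; apply: mem_set.
  - by exists 1; [exact: set_mem gen1 | exact: rmorph1].
  - exists (a *: u + v); last by rewrite linearP.
    by apply: set_mem; apply: genL; apply: mem_set.
  - exists (u * v); last by rewrite rmorphM.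
    by apply: set_mem; apply: genM; apply: mem_set.
have [gen1 genL genM] := gen_subalg_closed (F @` S).
apply: (Sx (F @^-1` gen_subalg (F @` S))); split; last first.
  by move=> u Su C [_]; apply; exists u.
split=> [|a u v /set_mem gu /set_mem gv|u v /set_mem gu /set_mem gv];
  apply: mem_set; rewrite /preimage /=; apply: set_mem.
- by rewrite rmorph1.
- by rewrite linearP; apply: genL; apply: mem_set.
- by rewrite rmorphM; apply: genM; apply: mem_set.
Qed.

Fact subalgebra_map_subproof (x : subalgebra S) :
  F (val x) \in in_gen_subalg (F @` S).
Proof.
apply: mem_set; rewrite gen_subalg_image; exists (val x) => //.
exact: set_mem (valP x).
Qed.

Definition subalgebra_map (x : subalgebra S) : subalgebra (F @` S) :=
  Subalgebra (subalgebra_map_subproof x).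

Fact subalgebra_map_linear : linear subalgebra_map.
Proof. by move=> a x y; apply: val_inj; rewrite /= linearP. Qed.

HB.instance Definition _ :=
  GRing.isLinear.Build K (subalgebra S) (subalgebra (F @` S)) *:%R
    subalgebra_map subalgebra_map_linear.

Fact subalgebra_map_monoid_morphism : monoid_morphism subalgebra_map.
Proof.
by split=> [|x y]; apply: val_inj; rewrite /= ?rmorph1 ?rmorphM.
Qed.

HB.instance Definition _ :=
  GRing.isMonoidMorphism.Build (subalgebra S) (subalgebra (F @` S))
    subalgebra_map subalgebra_map_monoid_morphism.

Lemma subalgebra_image_iso :
  injective F -> alg_isomorphic (subalgebra S) (subalgebra (F @` S)).
Proof.
move=> F_inj; exists subalgebra_map; rewrite -setTT_bijective; split=> //.
  by move=> x y _ _ /(congr1 val) /F_inj /val_inj.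
move=> y _; have := set_mem (valP y); rewrite gen_subalg_image => -[x gx Fx].
by exists (Subalgebra (mem_set gx)) => //; apply: val_inj.
Qed.

End GeneratedSubalgebraImage.

(** * Affine maps, lattice points and toric rings *)

Section AffineImage.
Context (d e : nat) (M : 'M[int]_(d, e)) (v : 'rV[int]_e).

Definition affine_map (R : realType) (x : 'rV[R]_d) : 'rV[R]_e :=
  x *m map_mx intr M + map_mx intr v.

Lemma conv_hull_affine (R : realType) (S : set 'rV[R]_d) :
  conv_hull (@affine_map R @` S) = @affine_map R @` conv_hull S.
Proof.
(* Weights summing to 1 allow the translation vector to be spread over the terms. *)
have affE k (p : 'I_k -> 'rV[R]_d) (c : 'I_k -> R) : \sum_i c i = 1 ->
    \sum_i c i *: affine_map (p i) = affine_map (\sum_i c i *: p i).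
  move=> c1; rewrite /affine_map mulmx_suml -[X in _ = _ + X]scale1r -c1.
  rewrite scaler_suml -big_split; apply: eq_bigr => i _ /=.
  by rewrite scalerDr scalemxAl.
apply/seteqP; split=> [_ [k [p [c [Sp c0 c1 ->]]]]
                      |_ [_ [k [p [c [Sp c0 c1 ->]]]] <-]].
  have /choice[q qP] i : exists x, S x /\ affine_map x = p i.
    by have [x] := Sp i; exists x.
  exists (\sum_i c i *: q i); first by exists k, q, c; split=> // i; case: (qP i).
  by rewrite -affE //; apply: eq_bigr => i _; case: (qP i) => _ ->.
by exists k, (fun i => affine_map (p i)), c; split=> // [i|];
  [exists (p i) | rewrite affE].
Qed.

(* Homogenizing makes [a |-> a M + v], read at [r = 1], additive. *)
Definition cone_map (x : 'rV[int]_d * nat) : 'rV[int]_e * nat :=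
  (x.1 *m M + v *+ x.2, x.2).

Fact cone_map_nmod_morphism : nmod_morphism cone_map.
Proof.
split=> [|x y]; first by rewrite /cone_map /= mul0mx mulr0n addr0.
by rewrite /cone_map /= mulmxDl mulrnDr addrACA.
Qed.

HB.instance Definition _ :=
  GRing.isNmodMorphism.Build ('rV[int]_d * nat)%type ('rV[int]_e * nat)%type
    cone_map cone_map_nmod_morphism.

Context (N : 'M[int]_(e, d)) (MN : M *m N = 1%:M).

(** The second component is preserved, so the multiples of [v] agree and cancel; [N] then undoes
    [M]. *)
Lemma cone_map_inj : injective cone_map.
Proof.
move=> [a r] [b s] [+ rs]; rewrite /= rs => /addIr /(congr1 (mulmx^~ N)).
by rewrite -!mulmxA MN !mulmx1 => ->.
Qed.

(** A point with integral image [b] must be [(b - v) *m N], which is integral because [N] is; hence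
    no new lattice points appear in the image. *)
Lemma lattice_points_affine (R : realType) (P : set 'rV[R]_d) :
  lattice_points (@affine_map R @` P) =
  (fun a => a *m M + v) @` lattice_points P.
Proof.
apply/seteqP; split=> [b [x Px xb]|_ [a Pa <-]].
  have xE : x = map_mx intr ((b - v) *m N).
    rewrite map_mxM raddfB /= -xb /affine_map addrK -mulmxA -map_mxM MN.
    by rewrite map_mx1 mulmx1.
  exists ((b - v) *m N); first by rewrite /lattice_points /= -xE.
  apply/rowP => j; apply: (@intr_inj R); have /rowP/(_ j) := xb.
  by rewrite xE /affine_map -map_mxM -map_mxD !mxE.
by exists (map_mx intr a) => //; rewrite /affine_map map_mxD map_mxM.
Qed.

(** The injective algebra morphism [ma_map cone_map] carries the generators of the first ring onto
    those of the second. *)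
Lemma toric_ring_affine (K : fieldType) (R : realType) (P : set 'rV[R]_d) :
  alg_isomorphic (toric_ring K P) (toric_ring K (@affine_map R @` P)).
Proof.
rewrite /toric_ring lattice_points_affine.
set S := (X in subalgebra X); set S' := (X in alg_isomorphic _ (subalgebra X)).
have -> : S' = (ma_map cone_map : laurent K d -> laurent K e) @` S.
  have mapE a : ma_map cone_map (monom K (a, 1%N)) = monom K (a *m M + v, 1%N).
    by rewrite /monom ma_mapU /cone_map /= mulr1n.
  apply/seteqP; split=> [_ [_ [a Pa <-] ->]|_ [_ [a Pa ->] <-]].
    by exists (monom K (a, 1%N)) => //; exists a.
  by exists (a *m M + v) => //; exists a.
apply: (@subalgebra_image_iso K (laurent K d) (laurent K e)).
exact/ma_map_inj/cone_map_inj.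
Qed.

End AffineImage.

(** * Graphs coned over one or two apexes *)

Section ConedGraph.
Context (n m : nat) (G : graph n) (iota : 'I_n -> 'I_m) (p q : 'I_m).
Context (c : 'I_n -> bool).

(* For [G] the complement graph, the constructors are the images of the stable
   sets of size 0, 1 and 2. *)
Inductive coned_edge : 'I_m -> 'I_m -> Prop :=
| coned_apex : coned_edge p q
| coned_side i : coned_edge (iota i) (if c i then q else p)
| coned_base i j : G i j -> coned_edge (iota i) (iota j).

Definition coned_adj : rel 'I_m :=
  fun u w => `[< coned_edge u w \/ coned_edge w u >].

Fact coned_adj_sym : symmetric coned_adj.
Proof.
by move=> u w; apply: asbool_equiv_eq; split=> -[]; [right|left|right|left].
Qed.

(** When [p = q], [coned_apex] is a loop and all side edges meet at it; when [p] and [q] differ, it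
    is an ordinary edge and [c] distributes the side edges between its ends. *)
Definition coned_graph : graph m := Graph coned_adj_sym.

End ConedGraph.

(** * The stable set polytope mapped onto an edge polytope *)

Section StableSetPolytope.
Context (K : fieldType) (R : realType) (n : nat) (G : graph n).
Hypothesis alphaG : (stability_number G <= 2)%N.

Lemma stable_le2 (W : {set 'I_n}) : stable G W ->
  [\/ W = finset.set0, exists i, W = [set i]%SET |
      exists i j, compl_adj G i j /\ W = [set i; j]%SET].
Proof.
move=> stW; have: (#|W| <= 2)%N.
  by apply: leq_trans alphaG; apply: (@leq_bigmax_cond _ (stable G) (fun W => #|W|)).
rewrite leq_eqVlt => /orP[/cards2P[i [j [ij WE]]]|]; last first.
  rewrite ltnS leq_eqVlt => /orP[/cards1P[i ->]|]; first by apply: Or32; exists i.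
  by rewrite ltnS leqn0 cards_eq0 => /eqP ->; apply: Or31.
apply: Or33; exists i, j; split=> //; rewrite /compl_adj ij /=.
have /forall_inP/(_ i) := stW; rewrite WE !inE eqxx => /(_ isT) /forall_inP/(_ j).
by rewrite !inE eqxx orbT ij => /(_ isT).
Qed.

Lemma stable0 : stable G finset.set0.
Proof. by apply/forall_inP => i; rewrite inE. Qed.

Lemma stable1 (i : 'I_n) : stable G [set i]%SET.
Proof.
apply/forall_inP => j /set1P ->; apply/forall_inP => k /set1P ->.
by rewrite eqxx.
Qed.

Lemma stable2 (i j : 'I_n) : compl_adj G i j -> stable G [set i; j]%SET.
Proof.
move=> /andP[ij Gij]; apply/forall_inP => k /set2P kP.
apply/forall_inP => l /set2P lP; apply/implyP.
by case: kP lP => -> [] ->; rewrite ?eqxx // adj_sym.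
Qed.

Lemma char_vec0 : char_vec R finset.set0 = 0 :> 'rV_n.
Proof. exact: big_set0. Qed.

Lemma char_vec1 (i : 'I_n) : char_vec R [set i]%SET = unit_vec R i.
Proof. exact: big_set1. Qed.

Lemma char_vec2 (i j : 'I_n) : i != j ->
  char_vec R [set i; j]%SET = unit_vec R i + unit_vec R j.
Proof. by move=> ij; rewrite /char_vec big_setU1 ?inE //= big_set1. Qed.

Context (m : nat) (iota : 'I_n -> 'I_m) (p q : 'I_m) (c : 'I_n -> bool).
Hypothesis iota_inj : injective iota.
Hypotheses (iota_p : forall i, iota i != p) (iota_q : forall i, iota i != q).
(** This ensures that the two ends of a complement edge have apexes summing to [p] plus [q] as unit
    vectors. *)
Hypothesis compl_c : forall i j, compl_adj G i j -> p = q \/ c i != c j.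

(** This is the apex to be subtracted. Since the origin goes to the sum of both, the other apex
    survives in the image of the [i]-th unit vector, hence the opposite test in [coned_side]. *)
Let apex i := if c i then p else q.

Let embed_mx : 'M[int]_(n, m) :=
  \matrix_i (delta_mx 0 (iota i) - delta_mx 0 (apex i)).

Let embed_row : 'rV[int]_m := delta_mx 0 p + delta_mx 0 q.

(** It reads off the coordinates at [iota i], thereby killing the unit vectors of [p] and [q]. *)
Let embed_inv : 'M[int]_(m, n) := \matrix_(u, i) (u == iota i)%:R.

Let embed_mxK : embed_mx *m embed_inv = 1%:M.
Proof.
apply/row_matrixP => i; rewrite row_mul rowK mulmxBl -!rowE; apply/rowP => j.
rewrite !mxE (inj_eq iota_inj) [apex i == _]eq_sym /apex.
by case: (c i); rewrite ?(negPf (iota_p _)) ?(negPf (iota_q _)) subr0.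
Qed.

Let embed := @affine_map n m embed_mx embed_row R.

Let embed_rowE : map_mx intr embed_row = unit_vec R p + unit_vec R q.
Proof. by rewrite map_mxD !map_delta_mx. Qed.

Let unit_vec_embed i :
  unit_vec R i *m map_mx intr embed_mx = unit_vec R (iota i) - unit_vec R (apex i).
Proof. by rewrite -rowE -map_row rowK map_mxB !map_delta_mx. Qed.

Let embed0 : embed 0 = unit_vec R p + unit_vec R q.
Proof. by rewrite /embed /affine_map mul0mx add0r embed_rowE. Qed.

Let embed1 i : embed (unit_vec R i) =
  unit_vec R (iota i) + unit_vec R (if c i then q else p).
Proof.
rewrite /embed /affine_map unit_vec_embed embed_rowE /apex.
by case: (c i); rewrite -addrA; congr (_ + _);
  [|rewrite [X in _ + X]addrC]; rewrite addKr.
Qed.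

Let embed2 i j : compl_adj G i j ->
  embed (unit_vec R i + unit_vec R j) = unit_vec R (iota i) + unit_vec R (iota j).
Proof.
move=> Gij; rewrite /embed /affine_map mulmxDl !unit_vec_embed embed_rowE.
(* The two subtracted apex vectors cancel the translation exactly. *)
rewrite [X in X + _]addrACA -opprD; have -> : unit_vec R (apex i) + unit_vec R (apex j) =
    unit_vec R p + unit_vec R q; last by rewrite subrK.
rewrite /apex; case: (compl_c Gij) => [->|]; first by rewrite !if_same.
by case: (c i) (c j) => [] [] // _; rewrite addrC.
Qed.

(** [H] is given only through its adjacency, so that the lemma applies both to [graph_star] and to
    [coned_graph]. *)
Lemma toric_ring_coned (H : graph m) :
  (forall u w, H u w <-> coned_edge (graph_compl G) iota p q c u w \/
                         coned_edge (graph_compl G) iota p q c w u) ->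
  alg_isomorphic (toric_ring K (stable_set_polytope R G))
                 (toric_ring K (edge_polytope R H)).
Proof.
move=> HP; suff -> : edge_polytope R H = embed @` stable_set_polytope R G.
  exact: toric_ring_affine embed_mxK _ _ _.
(* It remains to match the generating points: stable sets of size 0, 1, 2 against the three kinds of
   edges. *)
rewrite -conv_hull_affine; congr conv_hull; apply/seteqP; split.
  move=> _ [u [w [/HP Huw ->]]].
  (* The point of an edge does not depend on its orientation. *)
  wlog {Huw}: u w / coned_edge (graph_compl G) iota p q c u w.
    by move=> th; case: Huw => /th //; rewrite addrC.
  case=> [|i|i j Gij].
  - exists 0 => //; exists finset.set0; [exact: stable0 | by rewrite char_vec0].
  - exists (unit_vec R i) => //.
    by exists [set i]%SET; [exact: stable1 | rewrite char_vec1].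
  - exists (unit_vec R i + unit_vec R j); last exact: embed2.
    exists [set i; j]%SET; first exact: stable2.
    by rewrite char_vec2 //; case/andP: Gij.
move=> _ [_ [W /stable_le2 + ->] <-] => -[->|[i ->]|[i [j [Gij ->]]]].
- by rewrite char_vec0; exists p, q; split=> //; apply/HP; left; constructor.
- rewrite char_vec1; exists (iota i), (if c i then q else p); split=> //.
  by apply/HP; left; constructor.
- have ij : i != j by case/andP: Gij.
  rewrite char_vec2 //; exists (iota i), (iota j); split; last exact: embed2.
  by apply/HP; left; constructor.
Qed.

End StableSetPolytope.

(** * The star graph and the bipartite graph as coned graphs *)

Lemma graph_star_coned (n : nat) (G : graph n) (u w : 'I_n.+1) :
  graph_star G u w <->
  coned_edge G (lift ord_max) ord_max ord_max xpredT u w \/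
  coned_edge G (lift ord_max) ord_max ord_max xpredT w u.
Proof.
have star_coned x y : coned_edge G (lift ord_max) ord_max ord_max xpredT x y ->
    graph_star G x y.
  by case=> [|i|i j Gij]; rewrite /= /star_adj ?unlift_none ?liftK.
split; last by case=> /star_coned //; rewrite adj_sym.
rewrite /= /star_adj.
case: (unliftP ord_max u) => [i|] ->; case: (unliftP ord_max w) => [j|] ->.
- by left; constructor.
- by left; exact: (coned_side _ _ _ _ xpredT i).
- by right; exact: (coned_side _ _ _ _ xpredT j).
- by left; constructor.
Qed.

(** Put [p] on the side of [A] and [q] on the other: vertices of [A] are joined to [q], the
    remaining ones to [p]. *)
Lemma coned_graph_bipartite (n m : nat) (G : graph n) (iota : 'I_n -> 'I_m)
    (p q : 'I_m) (A : {set 'I_n}) :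
  injective iota -> (forall i, iota i != p) -> (forall i, iota i != q) ->
  p != q -> (forall i j, G i j -> (i \in A) != (j \in A)) ->
  bipartite (coned_graph G iota p q [in A]).
Proof.
move=> iota_inj iota_p iota_q pq AP; exists (p |: iota @: A)%SET => u w.
wlog Huw: u w / coned_edge G iota p q [in A] u w.
  by move=> th /asboolP[] Huw; [|rewrite eq_sym]; apply: th; rewrite // asboolE; left.
have iotaE i : (iota i \in (p |: iota @: A)%SET) = (i \in A).
  by rewrite !inE (negPf (iota_p i)) mem_imset.
have pA : p \in (p |: iota @: A)%SET by rewrite !inE eqxx.
have qA : (q \in (p |: iota @: A)%SET) = false.
  rewrite !inE eq_sym (negPf pq) /=; apply/imsetP => -[i _ qi].
  by have := iota_q i; rewrite -qi eqxx.
move=> _; case: Huw => [|i|i j Gij]; first by rewrite pA qA.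
  by rewrite iotaE; case: ifP; rewrite ?pA ?qA.
by rewrite !iotaE; apply: AP.
Qed.

Theorem lemma1p7 (K : fieldType) (R : realType) (n : nat) (G : graph n)
    (simpleG : simple_graph G) (alphaG : stability_number G = 2) :
  alg_isomorphic
    (toric_ring K (stable_set_polytope R G))
    (toric_ring K (edge_polytope R (graph_star (graph_compl G))))
  /\
  (bipartite (graph_compl G) ->
   exists (m : nat) (H : graph m),
     bipartite H /\
     alg_isomorphic
       (toric_ring K (stable_set_polytope R G))
       (toric_ring K (edge_polytope R H))).
Proof.
have alphaG2 : (stability_number G <= 2)%N by rewrite alphaG.
split=> [|[A AP]].
  (* The new vertex [ord_max] serves as both apexes, so [compl_c] holds by its first alternative. *)
  apply: (toric_ring_coned _ _ alphaG2 (@lift_inj _ ord_max) _ _ _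
            (@graph_star_coned _ _)) => *; rewrite 1?eq_sym ?neq_lift //.
  by left.
(* Two new vertices are appended as distinct apexes; membership in [A] alternates along complement
   edges, giving the second alternative of [compl_c]. *)
pose iota : 'I_n -> 'I_(n + 2) := @lshift n 2.
pose p : 'I_(n + 2) := rshift n ord0; pose q : 'I_(n + 2) := rshift n ord_max.
have iota_inj : injective iota by exact: lshift_inj.
have iota_p i : iota i != p by rewrite eq_lrshift.
have iota_q i : iota i != q by rewrite eq_lrshift.
exists (n + 2)%N, (coned_graph (graph_compl G) iota p q [in A]); split.
  by apply: coned_graph_bipartite; rewrite // eq_rshift.
apply: (toric_ring_coned _ _ alphaG2 iota_inj iota_p iota_q (c := [in A])).
  by move=> i j /AP; right.
by move=> u w; rewrite /= /coned_adj asboolE.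
Qed.
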